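(* Let $\tilde g^1,\dots,\tilde g^m$ be real polynomials of degree at most two in $y\in\mathbb{R}^n$, let $\mathbf{Y}=\{y\in\mathbb{R}^n:\tilde g^i(y)=0,\ i=1,\dots,m\}$, and for $\theta\in\mathbb{R}^n$ consider $$(E_\theta)\qquad\min_{y\in\mathbb{R}^n}\ \|y-\theta\|^2\quad\text{s.t.}\quad\tilde g^i(y)=0,\ i=1,\dots,m.$$ If $\bar\theta\in\mathbf{Y}$, then $(E_{\bar\theta})$ has zero duality gap.
   Context: For a quadratic polynomial $q(y)=y^\top Ay+2b^\top y+e$ ($A$ symmetric) let $M(q)=\begin{pmatrix}e&b^\top\\ b&A\end{pmatrix}\in\mathbb{S}^{n+1}$ be the matrix of its homogenization in the variables $x=(z_0,y)$, where $\mathbb{S}^{k}$ denotes real symmetric $k\times k$ matrices; write $E_{00}$ for the matrix with a single $1$ in the top left entry, and $\bullet$ for the trace inner product. The SDP relaxations of an inhomogeneous problem $\min\{\tilde f(y):\tilde g^i(y)=0,\ i=1,\dots,m\}$ are those of its homogenization (with constraint $z_0^2=1$), namely $$(P)\ \min_{S\in\mathbb{S}^{n+1}} M(\tilde f)\bullet S\ \text{ s.t. } M(\tilde g^i)\bullet S=0\ \forall i,\ E_{00}\bullet S=1,\ S\succeq0;$$ $$(D)\ \max_{\lambda_0\in\mathbb{R},\,\mu\in\mathbb{R}^m}-\lambda_0\ \text{ s.t. } M(\tilde f)+\lambda_0E_{00}+\sum_i\mu_iM(\tilde g^i)\succeq0.$$ Here $\tilde f(y)=\|y-\theta\|^2$.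 Zero duality gap means that the optimal value of the problem equals the optimal values of $(P)$ and of $(D)$. *)

(* Defs.v *)
From mathcomp Require Import all_boot all_order all_algebra.
(* mpoly must be imported before classical_sets: in the opposite order their
   notations clash. *)
From mathcomp Require Import mpoly.
From mathcomp Require Import classical_sets reals constructive_ereal ereal.

Set Implicit Arguments.
Unset Strict Implicit.
Unset Printing Implicit Defensive.

Import Order.TTheory GRing.Theory Num.Theory.

Local Open Scope classical_set_scope.
Local Open Scope ring_scope.

Section QuadraticProblems.
Context {R : realType}.

Definition polyval n (q : {mpoly R[n]}) (y : 'cV[R]_n) : R :=
  q.@[fun i => y i 0].

(* [msize] is one more than the total degree, and 0 for the zero
   polynomial. *)
Definition deg_le2 n (q : {mpoly R[n]}) : bool := (msize q <= 3)%N.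

(* For q(y) = y^T A y + 2 b^T y + e with A symmetric, the coefficient of y_i
   in q is 2 b_i, that of y_i^2 is A_ii, and that of y_i y_j (i != j) is
   2 A_ij. *)
Definition quad_e n (q : {mpoly R[n]}) : R := q@_0%MM.

Definition quad_b n (q : {mpoly R[n]}) : 'cV[R]_n :=
  \col_i (q@_U_(i)%MM / 2).

Definition quad_A n (q : {mpoly R[n]}) : 'M[R]_n :=
  \matrix_(i, j)
    let c := q@_(U_(i) + U_(j))%MM in
    if i == j then c else c / 2.

Definition hommx n (q : {mpoly R[n]}) : 'M[R]_(1 + n) :=
  block_mx (quad_e q)%:M (quad_b q)^T (quad_b q) (quad_A q).

Definition E00 n : 'M[R]_(1 + n) := delta_mx ord0 ord0.

Definition mxdot k (A B : 'M[R]_k) : R := \tr (A^T *m B).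

Definition psdmx k (A : 'M[R]_k) : Prop :=
  A^T = A /\ forall x : 'cV[R]_k, 0 <= (x^T *m A *m x) 0 0.

Section Problem.
Variables (n m : nat) (f : {mpoly R[n]}) (g : 'I_m -> {mpoly R[n]}).

Definition zero_locus : set 'cV[R]_n :=
  [set y | forall i, polyval (g i) y = 0].

(* Optimal values are extended reals: +oo for an infeasible minimization
   problem, -oo for an infeasible maximization problem. *)
Definition qp_value : \bar R :=
  ereal_inf [set (polyval f y)%:E | y in zero_locus].

Definition primal_feasible : set 'M[R]_(1 + n) :=
  [set S | [/\ forall i, mxdot (hommx (g i)) S = 0,
               mxdot (E00 n) S = 1 & psdmx S]].

Definition primal_value : \bar R :=
  ereal_inf [set (mxdot (hommx f) S)%:E | S in primal_feasible].

Definition dual_feasible : set (R * ('I_m -> R)) :=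
  [set p | psdmx (hommx f + p.1 *: E00 n + \sum_i p.2 i *: hommx (g i))].

Definition dual_value : \bar R :=
  ereal_sup [set (- p.1)%:E | p in dual_feasible].

Definition zero_duality_gap : Prop :=
  qp_value = primal_value /\ qp_value = dual_value.

End Problem.

(* ||y - theta||^2 for the Euclidean norm, as a polynomial in y. *)
Definition sqdist n (theta : 'cV[R]_n) : {mpoly R[n]} :=
  \sum_(i < n) ('X_i - (theta i 0)%:MP) ^+ 2.

Lemma polyval_sqdist n (theta y : 'cV[R]_n) :
  polyval (sqdist theta) y = \sum_(i < n) (y i 0 - theta i 0) ^+ 2.
Proof.
rewrite /polyval raddf_sum; apply: eq_bigr => i _.
by rewrite -[LHS]/(meval _ _) expr2 mevalM mevalB mevalXU mevalC -expr2.
Qed.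

End QuadraticProblems.

(* Main.v *)
Require Import Defs.
From HB Require Import structures.
From mathcomp Require Import all_boot all_order all_algebra.
From mathcomp Require Import mpoly.
From mathcomp Require Import classical_sets reals constructive_ereal ereal.
From mathcomp Require Import ring.

(** All three optimal values are 0, because the objective vanishes at the
    feasible point [theta] and is a sum of squares.

    The squares survive homogenization: the matrix of the objective is
    [\sum_i u_i *m u_i^T], where [u_i] holds the coefficients of the linear form
    [y_i - theta_i z_0] ([hommx_sqdist]).  It is therefore positive
    semidefinite, so that the zero multipliers are dual feasible with value 0,
    and its inner product with any positive semidefinite [S] is
    [\sum_i u_i^T *m S *m u_i], which is nonnegative.

    In the other direction, put [v = (1, theta)].  The quadratic form of the
    matrix of a polynomial of degree at most two takes at [v] the value of the
    polynomial at [theta] ([mxform_hommx]).  Hence [v *m v^T] is primal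
    feasible with value 0, and evaluating the form of a dual feasible matrix at
    [v] leaves [0 <= lambda_0], so that no dual value exceeds 0.

    The passage between polynomials and matrices is linear, so it is settled on
    monomials: numbering the monomials [1, y_1, ..., y_n] by the coordinates
    [z_0, y_1, ..., y_n], every monomial of degree at most two is a product of
    two of them, and the matrix of such a product is a symmetrized matrix
    unit. *)

Set Implicit Arguments.
Unset Strict Implicit.
Unset Printing Implicit Defensive.

Import Order.TTheory GRing.Theory Num.Theory.

Local Open Scope classical_set_scope.
Local Open Scope ring_scope.

(** * Monomials of degree at most two *)

(** The monomial obtained from the homogeneous coordinate [k] by setting
    [z_0 = 1]. *)
Definition mon n (k : 'I_(1 + n)) : 'X_{1..n} :=
  [multinom (k == rshift 1 i : nat) | i < n].

Lemma monE n (k : 'I_(1 + n)) i : mon k i = (k == rshift 1 i) :> nat.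
Proof. exact: mnmE. Qed.

Lemma mon0 n : mon (lshift n ord0) = 0%MM.
Proof. by apply/mnmP=> i; rewrite mnm0E. Qed.

Lemma monS n (i : 'I_n) : mon (rshift 1 i) = U_(i)%MM.
Proof. by apply/mnmP=> j; rewrite mnm1E. Qed.

Lemma mdeg_le1_mon n (m : 'X_{1..n}) : (mdeg m <= 1)%N -> exists k, m = mon k.
Proof.
rewrite leq_eqVlt ltnS leqn0 mdeg_eq0 => /orP[/mdeg1P[i /eqP ->]|/eqP ->].
  by exists (rshift 1 i); rewrite monS.
by exists (lshift n ord0); rewrite mon0.
Qed.

Lemma mdeg_le2_mon n (m : 'X_{1..n}) :
  (mdeg m <= 2)%N -> exists k l, m = (mon k + mon l)%MM.
Proof.
move=> m_le2; have [m0|[i m_i]] : m = 0%MM \/ exists i, m i != 0%N.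
- case: (boolP [exists i, m i != 0%N]) => [/existsP|/existsPn m0].
    by right.
  by left; apply/mnmP=> i; rewrite mnm0E; apply/eqP; rewrite -[_ == _]negbK.
- by exists (lshift n ord0), (lshift n ord0); rewrite mon0 addm0.
have defm : m = (U_(i) + (m - U_(i)))%MM by rewrite addmC submK // lep1mP.
have /mdeg_le1_mon[l ml] : (mdeg (m - U_(i)) <= 1)%N.
  by move: m_le2; rewrite defm mdegD mdeg1 -defm.
by exists (rshift 1 i), l; rewrite monS -ml.
Qed.

(** Unique factorization.  The exponents count the occurrences of each
    coordinate other than [z_0]; the occurrences of [z_0] are then determined
    as well, because both products have two factors. *)
Lemma monD_eq n (p r k l : 'I_(1 + n)) :
  ((mon p + mon r)%MM == (mon k + mon l)%MM) =
  (k == p) && (l == r) || (k == r) && (l == p).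
Proof.
apply/eqP/orP=> [/mnmP eqm|[] /andP[/eqP-> /eqP->] //]; last exact: addmC.
have eqS i : ((p == rshift 1 i) + (r == rshift 1 i) =
               (k == rshift 1 i) + (l == rshift 1 i))%N.
  by have := eqm i; rewrite !mnmDE !monE.
have total (a b : 'I_(1 + n)) : (\sum_i ((a == i) + (b == i)) = 2)%N.
  rewrite big_split /= (bigD1 a) //= eqxx big1 => [|i /negPf]; last first.
    by rewrite eq_sym => ->.
  by rewrite (bigD1 b) //= eqxx big1 // => i /negPf; rewrite eq_sym => ->.
have {eqS} count a : ((p == a) + (r == a) = (k == a) + (l == a))%N.
  case: (split_ordP a) => [z|i] -> //; rewrite ord1.
  have := etrans (total p r) (esym (total k l)).
  by rewrite !big_split_ord !big_ord1 (eq_bigr _ (fun i _ => eqS i)) => /addIn.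
have := count p; rewrite eqxx; have [kp _|_] := eqVneq k p.
  by left; have := count l; rewrite kp eqxx => /addnI; case: eqVneq.
have [lp _|_] := eqVneq l p; last by case: (r == p).
by right; have := count k; rewrite lp eqxx addnC => /addIn; case: eqVneq.
Qed.

(** * The matrix of a quadratic polynomial *)

Section Hommx.
Variables (R : realType) (n : nat).
Implicit Types (q : {mpoly R[n]}) (y : 'cV[R]_n).

(** The entries of all four blocks at once, indexed by pairs of coordinates. *)
Lemma hommxE q (k l : 'I_(1 + n)) :
  hommx q k l = q@_(mon k + mon l) * (if k == l then 1 else 2^-1).
Proof.
case: (split_ordP k) (split_ordP l) => i -> [] j ->.
- by rewrite block_mxEul !ord1 mon0 addm0 eqxx mulr1 mxE eqxx mulr1n.
- by rewrite block_mxEur !ord1 !mxE mon0 add0m monS eq_lrshift.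
- by rewrite block_mxEdl !ord1 !mxE mon0 addm0 monS eq_rlshift.
rewrite block_mxEdr mxE !monS (inj_eq (@rshift_inj _ _)).
by case: eqVneq; rewrite ?mulr1.
Qed.

Fact hommx_is_linear : linear (@hommx R n).
Proof.
move=> c p q; apply/matrixP=> k l.
by rewrite [RHS]mxE [in RHS]mxE !hommxE mcoeffD mcoeffZ mulrDl mulrA.
Qed.

HB.instance Definition _ :=
  GRing.isLinear.Build R {mpoly R[n]} 'M[R]_(1 + n) _ (@hommx R n)
    hommx_is_linear.

Lemma hommx_monD (p r : 'I_(1 + n)) :
  hommx 'X_[R, (mon p + mon r)%MM] = 2^-1 *: (delta_mx p r + delta_mx r p).
Proof.
apply/matrixP=> k l; rewrite hommxE mcoeffX monD_eq !mxE.
(* Only for [p = r] do the two matrix units meet, and then on the diagonal,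
   where the entry of the matrix is not halved. *)
have [/andP[/eqP-> /eqP->]|klpr] := boolP ((k == p) && (l == r)).
  rewrite [r == p]eq_sym andbb; case: eqVneq => _ /=; last by ring.
  by field.
have [/andP[/eqP kr /eqP lp]|_] /= := boolP ((k == r) && (l == p));
  last by ring.
by move: klpr; rewrite kr lp [p == r]eq_sym andbb => /negPf->; ring.
Qed.

(** The point [(1, y)] of the homogenized space. *)
Definition homvec y : 'cV[R]_(1 + n) := col_mx 1 y.

Lemma meval_mon y (k : 'I_(1 + n)) :
  ('X_[R, mon k]).@[fun i => y i 0] = homvec y k 0.
Proof.
case: (split_ordP k) => i ->.
  by rewrite ord1 mon0 mpolyX0 meval1 col_mxEu mxE.
by rewrite monS mevalXU col_mxEd.
Qed.

End Hommx.

(** * Quadratic forms and positive semidefinite matrices *)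

Definition mxform (R : realType) k (x : 'cV[R]_k) (A : 'M[R]_k) : R :=
  (x^T *m A *m x) 0 0.

Fact mxform_is_linear (R : realType) k (x : 'cV[R]_k) :
  scalar (mxform x).
Proof.
by move=> c A B; rewrite /mxform mulmxDr mulmxDl -scalemxAr -scalemxAl !mxE.
Qed.

HB.instance Definition _ (R : realType) k (x : 'cV[R]_k) :=
  GRing.isLinear.Build R 'M[R]_k R _ (mxform x) (mxform_is_linear x).

Lemma mxform_rank1 (R : realType) k (u v x : 'cV[R]_k) :
  mxform x (u *m v^T) = (u^T *m x) 0 0 * (v^T *m x) 0 0.
Proof.
rewrite /mxform mulmxA -mulmxA mxE big_ord1; congr (_ * _).
by rewrite -[x^T *m u]trmxK trmx_mul trmxK mxE.
Qed.

Lemma mxform_delta (R : realType) k (p r : 'I_k) (x : 'cV[R]_k) :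
  mxform x (delta_mx p r) = x p 0 * x r 0.
Proof.
have -> :
    delta_mx p r = delta_mx p (ord0 : 'I_1) *m (delta_mx r ord0)^T :> 'M[R]_k.
  by rewrite trmx_delta mul_delta_mx.
by rewrite mxform_rank1 !trmx_delta -!rowE !mxE.
Qed.

(** By linearity this is the case of a monomial, where both sides are the
    product of the same two coordinates of [(1, y)]. *)
Lemma mxform_hommx (R : realType) n (q : {mpoly R[n]}) (y : 'cV[R]_n) :
  deg_le2 q -> mxform (homvec y) (hommx q) = polyval q y.
Proof.
move=> q_le2; rewrite /polyval [q in LHS]mpolyE [q in RHS]mpolyE.
rewrite !linear_sum /= !big_seq; apply: eq_bigr => m q_m.
have [|k [l ->]] := @mdeg_le2_mon _ m.
  by rewrite -ltnS; apply: leq_trans q_le2; exact: msize_mdeg_lt.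
rewrite !linearZ /= mpolyXD mevalM !meval_mon -mpolyXD hommx_monD.
rewrite linearZ linearD /= !mxform_delta.
by congr (_ * _); field.
Qed.

Lemma mxdot_outer (R : realType) k (A : 'M[R]_k) (v : 'cV[R]_k) :
  mxdot A (v *m v^T) = mxform v A.
Proof.
rewrite /mxdot mulmxA mxtrace_mulC mulmxA trace_mx11.
by rewrite /mxform -[v^T *m A *m v]trmxK [RHS]mxE !trmx_mul trmxK mulmxA.
Qed.

Lemma mxdot_outerl (R : realType) k (A : 'M[R]_k) (u : 'cV[R]_k) :
  mxdot (u *m u^T) A = mxform u A.
Proof. by rewrite /mxdot trmx_mul trmxK -mulmxA mxtrace_mulC trace_mx11. Qed.

Lemma psd_outer (R : realType) k (u : 'cV[R]_k) : psdmx (u *m u^T).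
Proof.
split=> [|x]; first by rewrite trmx_mul trmxK.
by rewrite -/(mxform x _) mxform_rank1 -expr2 sqr_ge0.
Qed.

Lemma psd_sum (R : realType) k I (r : seq I) (A : I -> 'M[R]_k) :
  (forall i, psdmx (A i)) -> psdmx (\sum_(i <- r) A i).
Proof.
move=> psdA; split=> [|x].
  by rewrite raddf_sum; apply: eq_bigr => i _; case: (psdA i).
rewrite -/(mxform x _) linear_sum; apply: sumr_ge0 => i _.
by case: (psdA i) => _; exact.
Qed.

(** * The objective as a sum of squares *)

(** The linear form [y_i - theta_i z_0], which homogenizes [y_i - theta_i]. *)
Definition distform (R : realType) n (theta : 'cV[R]_n) (i : 'I_n) :
    'cV[R]_(1 + n) :=
  delta_mx (rshift 1 i) ord0 - theta i 0 *: delta_mx (lshift n ord0) ord0.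

Lemma distform_homvec (R : realType) n (theta : 'cV[R]_n) i :
  ((distform theta i)^T *m homvec theta) 0 0 = 0.
Proof.
rewrite linearB linearZ /= !trmx_delta mulmxBl -scalemxAl -!rowE.
by rewrite rowKd rowKu !mxE eqxx mulr1 subrr.
Qed.

(** Expanding each square on both sides gives the same combination of three
    monomials, respectively of their matrices. *)
Lemma hommx_sqdist (R : realType) n (theta : 'cV[R]_n) :
  hommx (sqdist theta) = \sum_i distform theta i *m (distform theta i)^T.
Proof.
rewrite linear_sum; apply: eq_bigr => i _.
rewrite /distform; set p := rshift 1 i; set o := lshift n ord0.
set t := theta i 0.
have -> : ('X_i - t%:MP) ^+ 2 = 'X_[R, (mon p + mon p)%MM]
    - (2 * t) *: 'X_[R, (mon p + mon o)%MM]
    + t ^+ 2 *: 'X_[R, (mon o + mon o)%MM] :> {mpoly R[n]}.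
  rewrite !mpolyXD mon0 monS mpolyX0 -!mul_mpolyC rmorphM rmorphXn.
  by rewrite rmorph_nat /=; ring.
rewrite linearD /= linearB /= !linearZ /= !hommx_monD.
apply/matrixP=> k l; rewrite !mxE big_ord1 !mxE eqxx !andbT -!mulnb !natrM.
by field.
Qed.

(** * Optimal values at a feasible point *)

Lemma ereal_inf_min (R : realType) (A : set (\bar R)) x :
  A x -> lbound A x -> ereal_inf A = x.
Proof.
move=> Ax lbx; apply/eqP; rewrite eq_le le_ereal_inf_tmp // andbT.
exact: ereal_inf_lbound.
Qed.

Lemma ereal_sup_max (R : realType) (A : set (\bar R)) x :
  A x -> ubound A x -> ereal_sup A = x.
Proof.
move=> Ax ubx; apply/eqP; rewrite eq_le ge_ereal_sup //=.
exact: ereal_sup_ubound.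
Qed.

Section Values.
Variables (R : realType) (n m : nat) (g : 'I_m -> {mpoly R[n]}).
Variable theta : 'cV[R]_n.
Hypothesis hg : forall i, deg_le2 (g i).
Hypothesis g_theta : zero_locus g theta.

Let v := homvec theta.

Lemma mxform_E00 (y : 'cV[R]_n) : mxform (homvec y) (E00 n) = 1.
Proof. by rewrite mxform_delta -[ord0](lshift0 _ 0) col_mxEu mxE mulr1. Qed.

Lemma mxform_sqdist : mxform v (hommx (sqdist theta)) = 0.
Proof.
rewrite hommx_sqdist linear_sum big1 //= => i _.
by rewrite mxform_rank1 distform_homvec mul0r.
Qed.

Lemma mxform_constraint i : mxform v (hommx (g i)) = 0.
Proof. by rewrite mxform_hommx. Qed.

Lemma qp_value0 : qp_value (sqdist theta) g = 0%E.
Proof.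
apply: ereal_inf_min => [|_ [y _ <-]].
  exists theta => //; rewrite polyval_sqdist big1 // => i _.
  by rewrite subrr expr0n.
by rewrite lee_fin polyval_sqdist; apply: sumr_ge0 => i _; exact: sqr_ge0.
Qed.

(** The rank-one matrix of [(1, theta)] attains the bound 0, which the sum of
    squares gives on all positive semidefinite matrices. *)
Lemma primal_value0 : primal_value (sqdist theta) g = 0%E.
Proof.
apply: ereal_inf_min => [|_ [S [_ _ [_ psdS]] <-]].
  exists (v *m v^T); last by rewrite mxdot_outer mxform_sqdist.
  split=> [i||]; last exact: psd_outer.
    by rewrite mxdot_outer mxform_constraint.
  by rewrite mxdot_outer mxform_E00.
rewrite lee_fin hommx_sqdist /mxdot raddf_sum mulmx_suml raddf_sum.
apply: sumr_ge0 => i _; rewrite -[X in 0 <= X]/(mxdot _ S) mxdot_outerl.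
exact: psdS.
Qed.

(** Zero multipliers attain 0.  Conversely, at [(1, theta)] the forms of the
    objective and of the constraints vanish and that of [E00] is 1, so a dual
    feasible matrix takes there the value of its first multiplier. *)
Lemma dual_value0 : dual_value (sqdist theta) g = 0%E.
Proof.
apply: ereal_sup_max => [|_ [[lambda mu] /= [_ psd_dual] <-]].
  exists (0, fun=> 0) => /=; last by rewrite oppr0.
  rewrite /dual_feasible /= scale0r addr0 big1 => [|i _]; last exact: scale0r.
  by rewrite addr0 hommx_sqdist; apply: psd_sum => i; exact: psd_outer.
have := psd_dual v; rewrite -/(mxform v _) !linearD /= mxform_sqdist add0r.
rewrite linearZ linear_sum /= mxform_E00 mulr1 big1 => [|i _].
  by rewrite addr0 lee_fin oppr_le0.
by rewrite linearZ /= mxform_constraint mulr0.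
Qed.

End Values.

Theorem corollary2p2 (R : realType) (n m : nat) (g : 'I_m -> {mpoly R[n]})
    (hg : forall i, deg_le2 (g i)) (theta : 'cV[R]_n) :
  zero_locus g theta -> zero_duality_gap (sqdist theta) g.
Proof.
by move=> g_theta; split; rewrite qp_value0 ?primal_value0 ?dual_value0.
Qed.
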